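(* There is an absolute constant $c$ such that the following holds. Let $G$ be a finite commutative group with $|G|=q$ and $3\nmid q$. Then there is a standard set $A\subset G$ such that $\overline\delta(A)=1/2$ and \[ \lambda^+(A)\le c\, q^{-1/6}(\log q)^{1/2}. \]
   Context: $G$ is written additively. A set $A\subset G$ is a standard set if $A=-A$ and $0\in A$. A character of $G$ is a homomorphism $\gamma:G\to\{z\in\mathbb C:|z|=1\}$; $\hat G$ is the group of characters and $\mathbf 1$ the principal character. For $f:G\to\mathbb R$, $\hat f(\gamma)=\sum_{x\in G}\gamma(x)f(x)$. For a standard set $A$: $\overline\Delta(A)=\max\{|B|:B\subset G,\ B-B\subset A\}$ and $\overline\delta(A)=1/\overline\Delta(A)$. Let $\mathcal S^+(A)$ be the set of functions $f:G\to\mathbb R$, not identically zero, with $f=0$ on $G\setminus A$ and $f\ge 0$ on $A$; then $\lambda^+(A)=\min\{f(0)/\hat f(\mathbf 1): f\in\mathcal S^+(A),\ \hat f(\gamma)\ge0\ \forall\gamma\in\hat G\}$.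
   Formalization: The formal theorem assumes q > 1; for q = 1 the claim is false, since the only standard set of the trivial group is {0}, for which δ̄(A) = 1 rather than 1/2. *)

(* Defs.v *)
From HB Require Import structures.
From mathcomp Require Import all_boot all_order all_algebra.
From mathcomp Require Import complex.
From mathcomp Require Import all_classical all_reals all_analysis.

Set Implicit Arguments.
Unset Strict Implicit.
Unset Printing Implicit Defensive.

Import Order.TTheory GRing.Theory Num.Theory.
Import numFieldNormedType.Exports.
Local Open Scope ring_scope.

Definition standard (G : finZmodType) (A : {set G}) : Prop :=
  A = [set - x | x in A]%SET /\ 0 \in A.

Definition Delta_bar (G : finZmodType) (A : {set G}) : nat :=
  \max_(B : {set G} | [set (x - y)%R | x in B, y in B]%SET \subset A) #|B|.

Definition delta_bar (R : realType) (G : finZmodType) (A : {set G}) : R :=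
  1 / (Delta_bar A)%:R.

Definition character (R : realType) (G : finZmodType) (gamma : G -> R[i]) : Prop :=
  (forall x y, gamma (x + y) = gamma x * gamma y) /\
  (forall x, `|gamma x| = 1).

Definition principal (R : realType) (G : finZmodType) : G -> R[i] := fun=> 1.
Arguments principal : clear implicits.

Definition fourier (R : realType) (G : finZmodType) (f : G -> R)
    (gamma : G -> R[i]) : R[i] :=
  \sum_(x : G) gamma x * ((f x)%:C)%C.

Definition S_plus (R : realType) (G : finZmodType) (A : {set G}) (f : G -> R) : Prop :=
  [/\ exists x, f x != 0,
      forall x, x \notin A -> f x = 0
    & forall x, x \in A -> 0 <= f x].

(* The order on R[i] is the partial one: 0 <= z means that z is real and
   nonnegative. *)
Definition lambda_plus_feasible (R : realType) (G : finZmodType) (A : {set G})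
    (f : G -> R) : Prop :=
  S_plus A f /\
  (forall gamma : G -> R[i], character gamma -> 0 <= fourier f gamma).

(* [fourier f (principal R G)] is the real number [\sum_x f x], cast into R[i];
   [complex.Re] casts it back. *)
Definition lambda_plus_ratio (R : realType) (G : finZmodType) (f : G -> R) : R :=
  f 0 / complex.Re (fourier f (principal R G)).

Local Open Scope classical_set_scope.

Definition lambda_plus_values (R : realType) (G : finZmodType) (A : {set G}) : set R :=
  [set lambda_plus_ratio f | f in [set f | lambda_plus_feasible A f]].
Arguments lambda_plus_values R {G} A.

(* For a standard set the infimum is a minimum: see [lambda_plus_min]. *)
Definition lambda_plus (R : realType) (G : finZmodType) (A : {set G}) : R :=
  inf (lambda_plus_values R A).

Lemma Re_fourier (R : realType) (G : finZmodType) (f : G -> R) gamma :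
  complex.Re (fourier f gamma) = \sum_(x : G) complex.Re (gamma x) * f x.
Proof.
rewrite /fourier; apply: (big_ind2 (fun a b => complex.Re a = b)) => [//|a b [u v] d <- <-|x _].
  by case: a.
by case: (gamma x) => a b /=; rewrite mulr0 subr0.
Qed.

Lemma Im_fourier (R : realType) (G : finZmodType) (f : G -> R) gamma :
  complex.Im (fourier f gamma) = \sum_(x : G) complex.Im (gamma x) * f x.
Proof.
rewrite /fourier; apply: (big_ind2 (fun a b => complex.Im a = b)) => [//|a b [u v] d <- <-|x _].
  by case: a.
by case: (gamma x) => a b /=; rewrite mulr0 add0r.
Qed.

Lemma fourier_principal (R : realType) (G : finZmodType) (f : G -> R) :
  complex.Re (fourier f (principal R G)) = \sum_(x : G) f x.
Proof. by rewrite Re_fourier; apply: eq_bigr => x _; rewrite mul1r. Qed.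

Lemma fourier_ge0E (R : realType) (G : finZmodType) (f : G -> R) gamma :
  (0 <= fourier f gamma) =
  (\sum_(x : G) complex.Im (gamma x) * f x == 0) &&
  (0 <= \sum_(x : G) complex.Re (gamma x) * f x).
Proof. by rewrite lecE Re_fourier Im_fourier. Qed.

Lemma S_plus_ge0 (R : realType) (G : finZmodType) (A : {set G}) (f : G -> R) x :
  S_plus A f -> 0 <= f x.
Proof.
by case=> _ f0 fge0; case: (boolP (x \in A)) => [/fge0|/f0 ->].
Qed.

Lemma S_plus_sum_gt0 (R : realType) (G : finZmodType) (A : {set G}) (f : G -> R) :
  S_plus A f -> 0 < \sum_(x : G) f x.
Proof.
move=> fA; have f_ge0 x : 0 <= f x by exact: S_plus_ge0 fA.
have [[x fx] _ _] := fA; rewrite lt_def sumr_ge0 ?andbT//.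
apply: contra fx => /eqP/psumr_eq0P fx0; apply/eqP.
by apply: fx0 => // y _; exact: f_ge0.
Qed.

Lemma character0 (R : realType) (G : finZmodType) (gamma : G -> R[i]) :
  character gamma -> gamma 0 = 1.
Proof.
move=> [gD g1]; have g0 : gamma 0 != 0 by rewrite -normr_eq0 g1 oner_eq0.
by apply: (mulfI g0); rewrite -gD addr0 mulr1.
Qed.

Lemma continuous_lin_comb (R : realType) (I : finType) (T : topologicalType)
    (w : I -> R) (h : I -> T -> R) :
  (forall i, continuous (h i)) -> continuous (fun t => \sum_(i : I) w i * h i t).
Proof.
move=> ch; apply: (@continuous_big R I +%R 0 xpredT _ T) => [|i _ t].
  exact: add_continuous.
by apply: cvgM; [exact: cvg_cst|exact: ch].
Qed.

Section attained.
Import ArrowAsProduct.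
Variables (R : realType) (G : finZmodType) (A : {set G}).

Let normalized : set (prod_topology (fun _ : G => R)) :=
  [set f | lambda_plus_feasible A f /\ \sum_(x : G) f x = 1].

Let lin_continuous (w : G -> R) :
  continuous (fun f : prod_topology (fun _ : G => R) => \sum_(x : G) w x * f x).
Proof.
apply: (@continuous_lin_comb R G (prod_topology (fun _ : G => R)) w (fun x f => f x)).
by move=> x; exact: (@proj_continuous _ (fun _ : G => R) x).
Qed.

Let normalizedE : normalized =
  [set f | forall x : G, x \notin A -> f x = 0] `&`
  [set f | forall x : G, 0 <= f x] `&`
  [set f | \sum_(x : G) f x = 1] `&`
  [set f | forall gamma : G -> R[i], character gamma ->
     \sum_(x : G) complex.Im (gamma x) * f x = 0] `&`
  [set f | forall gamma : G -> R[i], character gamma ->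
     0 <= \sum_(x : G) complex.Re (gamma x) * f x].
Proof.
apply/seteqP; split => f /=.
  move=> [[fA fF] f1]; split; [split; [split; [split|]|]|] => //.
  - by case: fA.
  - by move=> x; exact: S_plus_ge0 fA.
  - by move=> g /fF; rewrite fourier_ge0E => /andP[/eqP].
  - by move=> g /fF; rewrite fourier_ge0E => /andP[].
move=> [[[[fA f0] f1] fI] fR]; split => //; split; first split => //.
  apply: contrapT => /forallNP fz; move: f1; rewrite big1.
    by move/eqP; rewrite eq_sym oner_eq0.
  by move=> x _; apply/eqP/negbNE/negP/fz.
by move=> g gc; rewrite fourier_ge0E fR// fI// eqxx.
Qed.

Let normalized_compact : compact normalized.
Proof.
apply: (@subclosed_compact _ _
  [set f : prod_topology (fun _ : G => R) | forall x : G, `[(0:R), 1]%classic (f x)]).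
- have cp x : continuous (fun f : prod_topology (fun _ : G => R) => f x).
    exact: (@proj_continuous _ (fun _ : G => R) x).
  have cl (h : prod_topology (fun _ : G => R) -> R) D :
      continuous h -> closed D -> closed (h @^-1` D).
    by move=> ch; apply: preimage_closed => ? _; exact: ch.
  have clall I (P : I -> Prop) (F : I -> set (prod_topology (fun _ : G => R))) :
      (forall i, closed (F i)) -> closed [set f | forall i, P i -> F i f].
    by move=> cF; exact: (@closed_bigI _ _ P F).
  rewrite normalizedE; apply: closedI; [apply: closedI; [apply: closedI;
    [apply: closedI|]|]|].
  + apply: (clall _ (fun x => x \notin A) (fun x f => f x = 0)) => x.
    exact: (cl _ _ (cp x) (@closed_eq _ 0)).
  + rewrite (_ : [set f | _] =
      [set f : prod_topology (fun _ : G => R) | forall x : G, True -> 0 <= f x]).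
      apply: (clall _ (fun=> True) (fun x f => 0 <= f x)) => x.
      exact: (cl _ _ (cp x) (@closed_ge _ 0)).
    by apply/seteqP; split => f /= fx x; [move=> _|]; exact: fx.
  + have -> : [set f | \sum_(x : G) f x = 1] =
      (fun f : prod_topology (fun _ : G => R) => \sum_(x : G) 1 * f x) @^-1`
      [set x | x = 1].
      by apply/seteqP; split => f /=; rewrite -mulr_sumr mul1r.
    exact: (cl _ _ (@lin_continuous (fun=> 1)) (@closed_eq _ 1)).
  + apply: (clall _ (@character R G)
      (fun g f => \sum_(x : G) complex.Im (g x) * f x = 0)) => g.
    exact: (cl _ _ (@lin_continuous _) (@closed_eq _ 0)).
  + apply: (clall _ (@character R G)
      (fun g f => 0 <= \sum_(x : G) complex.Re (g x) * f x)) => g.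
    exact: (cl _ _ (@lin_continuous _) (@closed_ge _ 0)).
- by apply: (@tychonoff G (fun=> R) (fun=> `[0, 1]%classic)) => x;
  exact: segment_compact.
- move=> f [[fA _] f1] x /=; rewrite in_itv/= (S_plus_ge0 x fA)/= -f1.
  rewrite (bigD1 x)//= lerDl sumr_ge0// => y _; exact: S_plus_ge0 fA.
Qed.

Let normalize (f : G -> R) : lambda_plus_feasible A f ->
  exists2 g, normalized g & g 0 = lambda_plus_ratio f.
Proof.
move=> [fA fF]; have s0 := S_plus_sum_gt0 fA.
set s := \sum_(x : G) f x in s0.
exists (fun x => f x / s); last by rewrite /lambda_plus_ratio fourier_principal.
split; last by rewrite -mulr_suml divff// gt_eqF.
split.
  have [[x fx] f0 fge0] := fA; split.
  - by exists x; rewrite mulf_neq0// invr_neq0// gt_eqF.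
  - by move=> y yA; rewrite f0// mul0r.
  - by move=> y yA; rewrite divr_ge0// ?fge0// ltW.
move=> g gc; have := fF _ gc; rewrite !fourier_ge0E => /andP[/eqP fI fR].
under eq_bigr do rewrite mulrA.
rewrite -mulr_suml fI mul0r eqxx/=.
under eq_bigr do rewrite mulrA.
by rewrite -mulr_suml divr_ge0// ltW.
Qed.

Lemma lambda_plus_min : standard A ->
  lambda_plus_values R A (lambda_plus R A) /\
  lbound (lambda_plus_values R A) (lambda_plus R A).
Proof.
move=> [_ A0].
have N0 : normalized !=set0.
  pose d (x : G) : R := (x == 0)%:R.
  have sd (w : G -> R) : \sum_(x : G) w x * d x = w 0.
    rewrite (bigD1 0)//= /d eqxx mulr1 big1 ?addr0// => x /negbTE ->.
    by rewrite mulr0.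
  exists d; split; last first.
    by rewrite -[RHS](sd (fun=> 1)); apply: eq_bigr => x _; rewrite mul1r.
  split; first split.
  - by exists 0; rewrite /d eqxx oner_eq0.
  - by move=> x; rewrite /d; have [->|//] := eqVneq x 0; rewrite A0.
  - by move=> x _; rewrite /d ler0n.
  - move=> g gc.
    rewrite fourier_ge0E (sd (fun x => complex.Im (g x)))
      (sd (fun x => complex.Re (g x))).
    by rewrite (character0 gc)/= eqxx ler01.
have [|f /set_mem fN fmin] := @compact_EVT_min _ _
    (fun f : prod_topology (fun _ : G => R) => f 0) _ N0 normalized_compact.
  apply: continuous_subspaceT.
  exact: (@proj_continuous _ (fun _ : G => R) (0 : G)).
have fV : lambda_plus_values R A (f 0).
  exists f; first by case: fN.
  by rewrite /lambda_plus_ratio fourier_principal fN.2 divr1.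
have flb : lbound (lambda_plus_values R A) (f 0).
  by move=> _ [g /normalize[h hN <-] <-]; apply: fmin; exact: mem_set.
suff -> : lambda_plus R A = f 0 by [].
apply/eqP; rewrite eq_le; apply/andP; split.
  by apply: ge_inf => //; exists (f 0).
by apply: lb_le_inf => //; exists (f 0).
Qed.

End attained.

(* Main.v *)
(** Take [A] to consist of [0] and the elements [+-t_i] of a uniformly random
    [k]-tuple [t] in [G^k], with [k] of order [q^(1/3)].  The set has
    [Delta_bar A = 2] as soon as no relation [+-t_i +- t_j +- t_l = 0] holds;
    each of the [8k^3] relations has probability at most [1/q], since [3] does
    not divide [q], so the union bound applies.  The test function puts weight
    [1] on each [+-t_i] and [K] at [0]; its transform at a character [g] is
    [K + 2 \sum_i Re g(t_i)], and for nonprincipal [g] the Chernoff bound shows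
    that this is negative with probability at most [q^-3] when [K] is of order
    [sqrt (k log q)].  There are at most [q] characters, and the resulting ratio
    [K / 2k] has order [q^(-1/6) sqrt (log q)]. *)
Require Import Defs.
From mathcomp Require Import all_boot all_order all_algebra.
From mathcomp Require Import complex.
From mathcomp Require Import all_classical all_reals all_analysis.
From mathcomp Require Import ring lra zify.
Import Order.TTheory GRing.Theory Num.Theory.
Local Open Scope ring_scope.

Set Implicit Arguments.
Unset Strict Implicit.
Unset Printing Implicit Defensive.

(** * Sets in which no three nonzero elements sum to zero *)

Section Group.
Variable G : finZmodType.
Implicit Types (x y z : G) (A B : {set G}).

(** Translation by [x] permutes the group, so adding [x] to every element leaves the sum of all
    elements unchanged. *)
Lemma mulrn_card x : x *+ #|G| = 0.
Proof.
have h : bijective (fun y => y + x) by exists (fun y => y - x) => y; rewrite ?addrK ?subrK.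
have : \sum_(y : G) y = \sum_(y : G) (y + x).
  by rewrite [LHS](reindex _ (onW_bij _ h)).
rewrite big_split /= sumr_const -[LHS]addr0 => /addrI <-.
by [].
Qed.

Lemma mulr3n_eq0 x : ~~ (3 %| #|G|)%N -> x *+ 3 = 0 -> x = 0.
Proof.
move=> q3 x3; have := mulrn_card x.
rewrite (divn_eq #|G| 3) mulrnDr mulnC mulrnA x3 mul0rn add0r.
move: q3; rewrite /dvdn; have := ltn_pmod #|G| (isT : 0 < 3)%N.
case: (_ %% 3)%N => [|[|[|//]]] // _ _ x2.
by rewrite mulrS x2 addr0 in x3.
Qed.

(** Three distinct elements [a], [b], [d] of [B] would give nonzero differences [a - b], [b - d],
    [d - a] in [A] with sum zero. Conversely, the differences of the pair [0], [x] are [0] and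
    [+-x], all in [A]. *)
Lemma Delta_bar_eq2 A : standard A -> (exists2 x, x \in A & x != 0) ->
  (forall x y z, x \in A -> y \in A -> z \in A ->
     x != 0 -> y != 0 -> z != 0 -> x + y + z != 0) ->
  Delta_bar A = 2.
Proof.
move=> [AN A0] [x xA x0] tri; apply/eqP; rewrite eqn_leq; apply/andP; split.
  apply/bigmax_leqP => B /fintype.subsetP BA; rewrite leqNgt; apply/card_gt2P.
  move=> [a [b [d [[aB bB dB] [ab bd da]]]]].
  have mA u v : u \in B -> v \in B -> u - v \in A.
    by move=> uB vB; apply: BA; apply/imset2P; exists u v.
  have := tri (a - b) (b - d) (d - a) (mA _ _ aB bB) (mA _ _ bB dB) (mA _ _ dB aB).
  rewrite !subr_eq0 => /(_ ab bd da).
  by rewrite [a - b + _]addrA subrK addrA subrK subrr eqxx.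
rewrite /Delta_bar.
have -> : 2 = #|[set 0; x]%SET| by rewrite cards2 eq_sym x0.
apply: (leq_bigmax_cond (F := fun B : {set G} => #|B|)).
apply/fintype.subsetP => _ /imset2P[u v /set2P[]-> /set2P[]-> ->]; rewrite ?subr0 ?sub0r ?subrr //.
by rewrite AN; apply/imsetP; exists x.
Qed.

Definition signed (b : bool) x := if b then - x else x.

Lemma signedD b x y : signed b (x + y) = signed b x + signed b y.
Proof. by case: b => //=; rewrite opprD. Qed.

Lemma signedN b x : signed b (- x) = signed (~~ b) x.
Proof. by case: b => //=; rewrite opprK. Qed.

(** The map is additive, so its kernel decides; on it the map is multiplication by [+-1] or [+-3],
    and the group has no element of order 3. *)
Lemma signed3_inj b c d : ~~ (3 %| #|G|)%N ->
  injective (fun x => signed b x + signed c x + signed d x).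
Proof.
move=> q3 x y /eqP; rewrite -subr_eq0 => /eqP e; apply/eqP; rewrite -subr_eq0.
apply/eqP; move: e; set z := x - y.
have -> : signed b x + signed c x + signed d x - (signed b y + signed c y + signed d y) =
   signed b z + signed c z + signed d z.
  rewrite /z !signedD !signedN.
  by case: b; case: c; case: d => /=; rewrite !opprD ?opprK addrACA; congr (_ + _); rewrite addrACA.
have h : z + z + z = 0 -> z = 0.
  by move=> e; apply: mulr3n_eq0 => //; rewrite mulrS mulr2n addrA.
case: b; case: c; case: d => /=; rewrite ?subrr ?addNr ?add0r ?addrK ?subrK //.
- by move/(congr1 -%R); rewrite !opprD !opprK oppr0; exact: h.
- by move/eqP; rewrite oppr_eq0 => /eqP.
- by move/eqP; rewrite oppr_eq0 => /eqP.
- by move/eqP; rewrite oppr_eq0 => /eqP.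
Qed.

End Group.

Lemma leq_card_bigcup (I T : finType) (F : I -> {set T}) :
  (#|\bigcup_i F i| <= \sum_i #|F i|)%N.
Proof.
elim/big_rec2: _ => [|i n U _ leUn]; first by rewrite cards0.
by rewrite (leq_trans (leq_card_setU _ U).1) ?leq_add2l.
Qed.

(** * Random tuples, their three-term relations and the sets they define *)

Section Tuples.
Variables (G : finZmodType) (k : nat).
Implicit Types t u : {ffun 'I_k -> G}.

Definition relation_at (p : 'I_k * 'I_k * 'I_k * (bool * bool * bool)) t :=
  let: (i, j, l, (b, c, d)) := p in
  signed b (t i) + signed c (t j) + signed d (t l).

(** Indices may coincide: the relation [t i - t i + t i] makes every coordinate nonzero. *)
Definition relation_free t := [forall p, relation_at p t != 0].

(* Translating a solution by the constant tuple [x] changes the relation by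
   [+-x] or [+-3x], so each coset of the constants contains at most one
   solution. *)
Lemma card_relation p : ~~ (3 %| #|G|)%N ->
  (#|[set t | relation_at p t == 0%R]%SET| * #|G| <= #|G| ^ k)%N.
Proof.
case: p => [[[i j] l] [[b c] d]] q3; rewrite -[in leqRHS](card_ord k) -card_ffun -cardsT -cardsX.
set D := finset.setX _ _.
pose F (tx : {ffun 'I_k -> G} * G) := tx.1 + [ffun=> tx.2] : {ffun 'I_k -> G}.
rewrite -(card_in_imset (f := F) (D := D)) ?max_card//.
move=> [t x] [u y]; rewrite !inE !andbT /= /F /= => /eqP t0 /eqP u0 e.
have xy : x = y.
  apply: (@signed3_inj G b c d q3).
  have h (v : {ffun _ -> G}) z : signed b (v i) + signed c (v j) + signed d (v l) = 0 ->
     signed b z + signed c z + signed d z =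
     relation_at (i, j, l, (b, c, d)) (v + [ffun=> z] : {ffun _ -> G}).
    by move=> v0; rewrite -[LHS]add0r -v0 /= !ffunE !signedD [X in _ = X + _]addrACA [RHS]addrACA.
  by rewrite /= (h t x t0) (h u y u0) e.
by move: e; rewrite xy => /addIr ->.
Qed.

Lemma card_not_relation_free : ~~ (3 %| #|G|)%N ->
  (#|[set t | ~~ relation_free t]%SET| * #|G| <= 8 * k ^ 3 * #|G| ^ k)%N.
Proof.
move=> q3.
have sub : [set t | ~~ relation_free t]%SET \subset
    \bigcup_p [set t | relation_at p t == 0%R]%SET.
  apply/fintype.subsetP => t; rewrite inE negb_forall => /existsP[p].
  by rewrite negbK => h; apply/bigcupP; exists p; rewrite ?inE.
have bd := leq_trans (subset_leq_card sub) (leq_card_bigcup _).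
apply: leq_trans (leq_mul bd (leqnn _)) _.
rewrite big_distrl /=.
apply: (@leq_trans (\sum_(p : 'I_k * 'I_k * 'I_k * (bool * bool * bool)) #|G| ^ k)).
  by apply: leq_sum => p _; exact: card_relation.
rewrite sum_nat_const leq_mul2r; apply/orP; right.
rewrite !card_prod !card_ord card_bool; lia.
Qed.

Definition tuple_set t : {set G} :=
  [set x | (x == 0) || [exists i, (x == t i) || (x == - t i)]]%SET.

Lemma tuple_set_standard t : standard (tuple_set t).
Proof.
split; last by rewrite inE eqxx.
have sN x : x \in tuple_set t -> - x \in tuple_set t.
  rewrite !inE oppr_eq0 => /orP[->//|/existsP[i h]]; apply/orP; right.
  by apply/existsP; exists i; rewrite eqr_oppLR eqr_opp orbC.
apply/setP => x; apply/idP/imsetP => [xA|[y yA ->]]; last exact: sN.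
by exists (- x); rewrite ?opprK// sN.
Qed.

Lemma tuple_set_signed t x : x \in tuple_set t -> x != 0 ->
  exists i b, x = signed b (t i).
Proof.
rewrite inE => /orP[->//|/existsP[i /orP[]/eqP-> _]].
  by exists i, false.
by exists i, true.
Qed.

Lemma relation_free_neq0 t i : relation_free t -> t i != 0.
Proof. by move=> /forallP/(_ (i, i, i, (false, true, false))) /=; rewrite subrr add0r. Qed.

Lemma Delta_bar_tuple_set t : (0 < k)%N -> relation_free t ->
  Delta_bar (tuple_set t) = 2.
Proof.
move=> k0 tf; apply: Delta_bar_eq2; first exact: tuple_set_standard.
  exists (t (Ordinal k0)); last exact: relation_free_neq0.
  by rewrite inE; apply/orP; right; apply/existsP; exists (Ordinal k0); rewrite eqxx.
move=> x y z xA yA zA x0 y0 z0.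
have [i [b ->]] := tuple_set_signed xA x0.
have [j [c ->]] := tuple_set_signed yA y0.
have [l [d ->]] := tuple_set_signed zA z0.
exact: (forallP tf (i, j, l, (b, c, d))).
Qed.

End Tuples.

(** * Characters: symmetry, orthogonality and number *)

Section Characters.
Variables (R : realType) (G : finZmodType).
Implicit Types (g h : G -> R[i]) (x y : G).

Lemma character_neq0 g x : character g -> g x != 0.
Proof. by move=> [_ g1]; rewrite -normr_eq0 g1 oner_eq0. Qed.

Lemma characterN g x : character g -> g (- x) = (g x)^-1.
Proof.
move=> gc; apply: (mulfI (character_neq0 x gc)).
by rewrite -gc.1 subrr character0// divff// character_neq0.
Qed.

Lemma characterN_conj g x : character g -> g (- x) = (g x)^*.
Proof. by move=> gc; rewrite characterN// invC_norm gc.2 expr1n invr1 mul1r. Qed.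

Lemma Re_characterN g x : character g -> complex.Re (g (- x)) = complex.Re (g x).
Proof. by move=> gc; rewrite characterN_conj//; case: (g x). Qed.

Lemma Im_characterN g x : character g -> complex.Im (g (- x)) = - complex.Im (g x).
Proof. by move=> gc; rewrite characterN_conj//; case: (g x). Qed.

Lemma Re_character_le1 g x : character g -> `|complex.Re (g x)| <= 1.
Proof. by move=> gc; have := normc_ge_Re (g x); rewrite gc.2 lecR. Qed.

(** Shifting the summation variable by [y] multiplies the sum by [g y]. *)
Lemma sum_character g y : character g -> g y != 1 -> \sum_x g x = 0.
Proof.
move=> gc gy; have hb : bijective (fun x => y + x).
  by exists (fun x => - y + x) => x; rewrite ?addKr ?addNKr.
have e : \sum_x g x = g y * \sum_x g x.
  rewrite [LHS](reindex _ (onW_bij _ hb)) mulr_sumr.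
  by apply: eq_bigr => x _; rewrite gc.1.
apply/eqP; have : (1 - g y) * \sum_x g x == 0 by rewrite mulrBl mul1r -e subrr.
by rewrite mulf_eq0 subr_eq0 eq_sym (negbTE gy).
Qed.

Lemma character_div g h : character g -> character h ->
  character (fun x => g x / h x).
Proof.
move=> gc hc; split=> [x y|x]; last by rewrite normf_div gc.2 hc.2 divr1.
by rewrite gc.1 hc.1 invfM mulrACA.
Qed.

(* By orthogonality the matrix of values of the characters has full row rank. *)
Lemma size_characters (s : seq {ffun G -> R[i]}) : uniq s ->
  (forall g : {ffun G -> R[i]}, g \in s -> character g) -> (size s <= #|G|)%N.
Proof.
move=> us cs; pose c (i : 'I_(size s)) := nth [ffun=> 0] s i.
have cc i : character (c i) by apply: cs; exact: mem_nth.
have q0 : #|G|%:R != 0 :> R[i].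
  by rewrite pnatr_eq0 -lt0n; apply/card_gt0P; exists 0.
pose M : 'M[R[i]]_(size s, #|G|) := \matrix_(i, j) c i (enum_val j).
pose N : 'M[R[i]]_(#|G|, size s) := \matrix_(j, i) ((c i (enum_val j))^-1 / #|G|%:R).
(* The product is the identity by orthogonality, while its rank is at most the inner dimension
   [#|G|]. *)
have <- : \rank (M *m N) = size s; last exact: mulmx_max_rank.
suff -> : M *m N = 1%:M by exact: mxrank1.
apply/matrixP => i j; rewrite !mxE.
under eq_bigr do rewrite !mxE mulrA.
rewrite -mulr_suml.
have -> : \sum_(l < #|G|) c i (enum_val l) / c j (enum_val l) =
    \sum_x c i x / c j x.
  by rewrite [RHS](reindex _ (onW_bij _ (@enum_val_bij G))).
have [->|ij] := eqVneq i j.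
  under eq_bigr do rewrite divff ?character_neq0//.
  by rewrite sumr_const divff.
have [x cx] : exists x, c i x != c j x.
  apply: contrapT => /forallNP h; move/eqP: ij; apply; apply/val_inj/eqP.
  rewrite /= -(nth_uniq [ffun=> 0] (ltn_ord i) (ltn_ord j) us).
  by apply/eqP/ffunP => x; apply/eqP/negPn/negP/h.
rewrite (@sum_character _ x (character_div (cc i) (cc j))) ?mul0r//.
by rewrite -subr_eq0 -{1}(divff (character_neq0 x (cc j))) -mulrBl
  mulf_neq0 ?invr_neq0 ?character_neq0// subr_eq0.
Qed.

End Characters.

(** * Exponential moments and the Chernoff bound *)

Lemma expR_le_quadratic (R : realType) (u : R) : u <= 1 / 2 ->
  expR u <= 1 + u + 2 * u ^+ 2.
Proof.
move=> u2; have := expR_ge1Dx (- u); rewrite expRN => h.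
have u1 : 0 < 1 - u by lra.
(* It remains to see that [(1 + u + 2 * u ^+ 2) * (1 - u)] is at least 1, which is where
   [u <= 1 / 2] enters. *)
have : expR u <= (1 - u)^-1 by rewrite -[leLHS]invrK lef_pV2 ?posrE ?invr_gt0 ?expR_gt0.
move=> /le_trans; apply; rewrite -[leLHS]mul1r ler_pdivrMr//.
have : 0 <= u ^+ 2 * (1 - 2 * u) by rewrite mulr_ge0 ?sqr_ge0//; lra.
rewrite (_ : (1 + u + 2 * u ^+ 2) * (1 - u) = 1 + u ^+ 2 * (1 - 2 * u)); last by ring.
lra.
Qed.

Section Chernoff.
Variables (R : realType) (G : finZmodType) (k : nat).
Implicit Types (t : {ffun 'I_k -> G}) (g : G -> R[i]).

(** The sum over tuples factors into a [k]-th power of a sum over the group. There the linear term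
    of the quadratic bound vanishes by orthogonality, leaving [#|G| * (1 + 2 * s ^+ 2)]. *)
Lemma character_exp_moment g y (s : R) : character g -> g y != 1 ->
  0 <= s <= 1 / 2 ->
  \sum_(t : {ffun 'I_k -> G}) expR (- s * \sum_i complex.Re (g (t i)))
    <= #|G|%:R ^+ k * expR (2 * s ^+ 2 * k%:R).
Proof.
move=> gc gy /andP[s0 s1].
under eq_bigr do rewrite mulr_sumr expR_sum.
rewrite -(bigA_distr_bigA (fun _ x => expR (- s * complex.Re (g x)))) /=.
rewrite prodr_const card_ord expRM_natr -exprMn.
apply: lerXn2r; rewrite ?nnegrE ?mulr_ge0 ?expR_ge0 ?sumr_ge0//.
have bd x : expR (- s * complex.Re (g x)) <= (1 + 2 * s ^+ 2) + - s * complex.Re (g x).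
  have := Re_character_le1 x gc; rewrite ler_norml; set r := complex.Re _ => /andP[r1 r2].
  have r3 : r ^+ 2 <= 1 by nra.
  apply: le_trans (expR_le_quadratic _) _; first nra.
  rewrite exprMn sqrrN; have := sqr_ge0 s; nra.
apply: le_trans (ler_sum _ (fun x _ => bd x)) _.
rewrite big_split /= sumr_const -mulr_sumr.
have -> : \sum_x complex.Re (g x) = 0.
  have := Re_fourier (fun=> 1) g; under [RHS]eq_bigr do rewrite mulr1.
  move=> <-; rewrite /fourier; under eq_bigr do rewrite mulr1.
  by rewrite (sum_character gc gy).
rewrite mulr0 addr0 -[leLHS]mulr_natl ler_wpM2l//; exact: expR_ge1Dx.
Qed.

(** Markov's inequality: each counted tuple contributes at least [expR (s * a)] to the exponential
    moment. *)
Lemma card_character_sum_lt g y (s a : R) : character g -> g y != 1 ->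
  0 <= s <= 1 / 2 ->
  #|[set t : {ffun 'I_k -> G} | \sum_i complex.Re (g (t i)) < - a]%SET|%:R * expR (s * a)
    <= #|G|%:R ^+ k * expR (2 * s ^+ 2 * k%:R).
Proof.
move=> gc gy s01; apply: le_trans (character_exp_moment gc gy s01).
rewrite -sum1_card natr_sum mulr_suml big_mkcond /=; apply: ler_sum => t _.
rewrite inE; case: ifP => [h|_]; last exact: expR_ge0.
rewrite mul1r ler_expR mulNr -mulrN ler_wpM2l//; first by case/andP: s01.
by rewrite lerNr ltW.
Qed.

End Chernoff.

(** * The test function and the bounds on [lambda_plus] *)

Section TestFunction.
Variables (R : realType) (G : finZmodType) (k : nat).
Implicit Types (t : {ffun 'I_k -> G}) (K : R).

(** Coinciding coordinates are counted with multiplicity, so the total mass is [K + 2 * k] for every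
    tuple. *)
Definition test_fun K t (x : G) : R :=
  K * (x == 0)%:R + \sum_i ((x == t i)%:R + (x == - t i)%:R).

Lemma sum_test_fun K t (w : G -> R) :
  \sum_x w x * test_fun K t x = K * w 0 + \sum_i (w (t i) + w (- t i)).
Proof.
have d (y : G) : \sum_x w x * (x == y)%:R = w y.
  rewrite (bigD1 y)//= eqxx mulr1 big1 ?addr0// => x /negbTE ->.
  by rewrite mulr0.
under eq_bigr do rewrite mulrDr mulrCA mulr_sumr.
rewrite big_split /= -mulr_sumr d exchange_big /=; congr (_ + _).
apply: eq_bigr => i _; under eq_bigr do rewrite mulrDr.
by rewrite big_split /= !d.
Qed.

(** Imaginary parts cancel between [t i] and [- t i], and the real part [K + 2 \sum_i Re g(t_i)] is
    nonnegative by the last hypothesis. The ratio is [K / (K + 2 * k)], since no coordinate is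
    zero. *)
Lemma lambda_plus_le_test_fun K t : 0 <= K -> (0 < k)%N -> relation_free t ->
  (forall g : G -> R[i], character g ->
     - (K / 2) <= \sum_i complex.Re (g (t i))) ->
  lambda_plus R (tuple_set t) <= K / (2 * k%:R).
Proof.
move=> K0 k0 tf good; have stA := tuple_set_standard t.
have f0 : test_fun K t 0 = K.
  rewrite /test_fun eqxx mulr1 big1 ?addr0// => i _.
  by rewrite !(eq_sym 0) oppr_eq0 (negbTE (relation_free_neq0 i tf)) addr0.
have fs : \sum_x test_fun K t x = K + 2 * k%:R.
  have := sum_test_fun K t (fun=> 1); under eq_bigr do rewrite mul1r.
  by move=> ->; rewrite sumr_const card_ord mulr1 mulr_natr.
have fge x : 0 <= test_fun K t x.
  by rewrite addr_ge0 ?mulr_ge0 ?sumr_ge0// => i _; rewrite addr_ge0.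
have k0R : 0 < k%:R :> R by rewrite ltr0n.
have feas : lambda_plus_feasible (tuple_set t) (test_fun K t).
  split; first split => //.
  - apply: contrapT => /forallNP h; have := fs; rewrite big1; first by lra.
    by move=> x _; apply/eqP/negPn/negP/h.
  - move=> x; rewrite inE negb_or negb_exists => /andP[/negbTE x0 /forallP h].
    rewrite /test_fun x0 mulr0 add0r big1// => i _.
    by have := h i; rewrite negb_or => /andP[/negbTE-> /negbTE->]; rewrite addr0.
  - move=> g gc; rewrite fourier_ge0E !sum_test_fun character0//=.
    rewrite mulr0 add0r big1 ?eqxx/=; last by move=> i _; rewrite Im_characterN// subrr.
    under eq_bigr do rewrite Re_characterN// -mulr2n.
    by rewrite sumrMnl -mulr_natr mulr1; have := good g gc; lra.
have [_ lb] := @lambda_plus_min R G _ stA.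
apply: le_trans (lb _ (ex_intro2 _ _ _ feas erefl)) _.
rewrite /lambda_plus_ratio fourier_principal f0 fs.
rewrite ler_wpM2l// lef_pV2 ?posrE; lra.
Qed.

(** A nonnegative function has [f 0] at most its total mass; this settles the case where the claimed
    bound is at least 1. *)
Lemma lambda_plus_le1 (A : {set G}) : standard A -> lambda_plus R A <= 1.
Proof.
move=> /(@lambda_plus_min R G) [[f [fA _] <-] _].
have f0 := S_plus_ge0 _ fA; have fs := S_plus_sum_gt0 fA.
rewrite /lambda_plus_ratio fourier_principal ler_pdivrMr// mul1r (bigD1 0)//=.
by rewrite lerDl sumr_ge0.
Qed.

End TestFunction.

(** * Union bound over relations and characters *)

Lemma exists_good_tuple (R : realType) (G : finZmodType) (k : nat) (s : R) :
  (1 < #|G|)%N -> ~~ (3 %| #|G|)%N -> (16 * k ^ 3 <= #|G|)%N ->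
  0 <= s <= 1 / 2 -> s ^+ 2 * k%:R = ln #|G|%:R ->
  exists2 t : {ffun 'I_k -> G}, relation_free t &
    forall g : G -> R[i], character g ->
      - (5 * k%:R * s) <= \sum_i complex.Re (g (t i)).
Proof.
move=> q1 q3 kq s01 sk; apply: contrapT => nogood.
pose bad (g : {ffun G -> R[i]}) : {set {ffun 'I_k -> G}} :=
  [set t : {ffun 'I_k -> G} | \sum_i complex.Re (g (t i)) < - (5 * k%:R * s)]%SET.
(* Each relation-free tuple gets a character violating the bound, so only the finitely many chosen
   characters need counting. On other tuples [c] is arbitrary. *)
have /choice [c cP] : forall t : {ffun 'I_k -> G}, exists g : {ffun G -> R[i]},
    relation_free t -> character g /\ t \in bad g.
  move=> t; apply: contrapT => /forallNP h; apply: nogood; exists t.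
    by apply/negPn/negP => tn; apply: (h [ffun=> 0]) => tf; rewrite tf in tn.
  move=> g gc; rewrite leNgt; apply/negP => gt; apply: (h (finfun g)) => _.
  have gE : (finfun g : G -> R[i]) = g by apply: funext => x; rewrite ffunE.
  by rewrite inE gE.
pose free := [set t : {ffun 'I_k -> G} | relation_free t]%SET.
pose l := undup [seq c t | t <- enum free].
(* The trivial character is never chosen: its sum is nonnegative, hence not below
   [- (5 * k%:R * s)]. *)
have lP g : g \in l -> character g /\ exists y, g y != 1.
  rewrite mem_undup => /mapP[t]; rewrite mem_enum inE => /cP[gc tb] ->.
  split=> //; apply: contrapT => /forallNP h; move: tb.
  rewrite inE ltNge; apply/negP/negPn.
  apply: (@le_trans _ _ 0); first by rewrite oppr_le0 !mulr_ge0//; case/andP: s01.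
  by apply: sumr_ge0 => i _; have /negP/negPn/eqP -> := h (t i).
have lsize : (size l <= #|G|)%N.
  apply: (@size_characters R G l (undup_uniq _)) => g gl; exact: (lP g gl).1.
have q0 : 0 < #|G|%:R :> R by rewrite ltr0n (ltn_trans _ q1).
(* With threshold [5 * k * s], the two Chernoff exponents are [5 ln #|G|] and [2 ln #|G|], so a bad
   set has density at most [#|G| ^ -3]. *)
have badP g : g \in l -> (#|bad g| * #|G| ^ 5 <= #|G| ^ k * #|G| ^ 2)%N.
  move=> /lP[gc [y gy]].
  have := @card_character_sum_lt R G k g y s (5 * k%:R * s) gc gy s01.
  have -> : s * (5 * k%:R * s) = 5%:R * ln #|G|%:R by rewrite -sk; ring.
  have -> : 2 * s ^+ 2 * k%:R = 2%:R * ln #|G|%:R by rewrite -sk; ring.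
  by rewrite -/(bad g) !expRM_natl !lnK ?posrE// -!natrX -!natrM ler_nat.
have freeP : (#|free| <= \sum_(g <- l) #|bad g|)%N.
  under eq_bigr do rewrite -sum1_card big_mkcond /=.
  rewrite exchange_big /= -sum1_card big_mkcond /=; apply: leq_sum => t _.
  case: ifP => //; rewrite inE => tf; have [_ tb] := cP t tf.
  have cl : c t \in l by rewrite mem_undup map_f// mem_enum inE.
  by rewrite (big_rem _ cl) /= tb leq_addr.
have free5 : (#|free| * #|G| ^ 5 <= #|G| * (#|G| ^ k * #|G| ^ 2))%N.
  apply: leq_trans (leq_mul freeP (leqnn _)) _; rewrite big_distrl /=.
  apply: (@leq_trans (\sum_(g <- l) #|G| ^ k * #|G| ^ 2)%N).
    by rewrite [leqLHS]big_seq [leqRHS]big_seq; apply: leq_sum => g; exact: badP.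
  by rewrite big_const_seq count_predT iter_addn_0 mulnC leq_mul2r lsize orbT.
have tot : (#|free| + #|~: free|)%N = (#|G| ^ k)%N.
  by rewrite cardsC card_ffun card_ord.
have Qk : (0 < #|G| ^ k)%N by rewrite expn_gt0 (ltn_trans _ q1).
have nf : (#|~: free| * #|G| <= 8 * k ^ 3 * #|G| ^ k)%N.
  have -> : (~: free) = [set t | ~~ relation_free t]%SET.
    by apply/setP => t; rewrite !inE.
  exact: card_not_relation_free.
(* Summing over at most [#|G|] characters gives density at most [#|G| ^ -2], hence at most 1/4. With
   at most 1/2 for the tuples having a relation, the two parts cannot fill the whole space. *)
have free2 : (4 * #|free| <= #|G| ^ k)%N.
  have : (#|free| * #|G| ^ 2 * #|G| ^ 3 <= #|G| ^ k * #|G| ^ 3)%N.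
    by rewrite -mulnA -expnD (leq_trans free5)// (expnD _ 1 2) expn1; apply/eq_leq; ring.
  rewrite leq_pmul2r ?expn_gt0 ?(ltn_trans _ q1)//; apply: leq_trans.
  by rewrite mulnC leq_mul2l -[4%N]/(2 ^ 2)%N leq_exp2r// q1 orbT.
have nf2 : (2 * #|~: free| <= #|G| ^ k)%N.
  rewrite -(@leq_pmul2r #|G|) ?(ltn_trans _ q1)//.
  have : (16 * k ^ 3 * #|G| ^ k <= #|G| * #|G| ^ k)%N by rewrite leq_mul2r kq orbT.
  rewrite [X in (_ <= X)%N]mulnC; apply: leq_trans.
  by rewrite -mulnA (_ : 16 = 2 * 8)%N// -(mulnA 2) -(mulnA 2 (8 * _)%N) leq_mul2l nf orbT.
lia.
Qed.

(** * Choice of [k] and numerical estimates *)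

Lemma cube_scale (q : nat) : (16 <= q)%N ->
  exists k, [/\ (0 < k)%N, (16 * k ^ 3 <= q)%N & (q <= (8 * k) ^ 3)%N].
Proof.
move=> q16; have ex : exists k, (16 * k ^ 3 <= q)%N by exists 1%N.
have ub k : (16 * k ^ 3 <= q -> k <= q)%N.
  by move=> h; apply: leq_trans h; case: k => // k; rewrite !expnS expn0; nia.
have [k kq kmax] := ex_maxnP ex ub; have k0 := kmax 1%N q16.
exists k; split => //; rewrite leqNgt; apply/negP => h.
(* If the upper bound failed, [k.+1 <= 2 * k] would give [16 * k.+1 ^ 3 <= 128 * k ^ 3 <= (8 * k) ^
   3 < q], against maximality. *)
have /kmax : (16 * k.+1 ^ 3 <= q)%N; last by rewrite ltnn.
apply: leq_trans (ltnW h); rewrite expnMn.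
have : (k.+1 ^ 3 <= (2 * k) ^ 3)%N by rewrite leq_exp2r//; lia.
rewrite expnMn; lia.
Qed.

(** Any nonzero element will do, by injectivity of the signed sums; one generator suffices when the
    bound on [lambda_plus] is trivial. *)
Lemma exists_relation_free1 (G : finZmodType) : (1 < #|G|)%N -> ~~ (3 %| #|G|)%N ->
  exists t : {ffun 'I_1 -> G}, relation_free t.
Proof.
move=> /card_gt1P [x [y [_ _ xy]]] q3.
have [z z0] : exists z : G, z != 0.
  by have [x0|x0] := eqVneq x 0; [exists y; rewrite -x0 eq_sym|exists x].
exists [ffun=> z]; apply/forallP => -[[[i j] l] [[b c] d]] /=; rewrite !ffunE.
have e : signed b (0 : G) + signed c 0 + signed d 0 = 0.
  by case: b; case: c; case: d; rewrite /= ?oppr0 !addr0.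
by rewrite -e; apply: contra z0 => /eqP /(signed3_inj q3) ->.
Qed.

Section Scale.
Variables (R : realType) (q : nat).
Hypothesis q1 : (1 < q)%N.
Let a : R := q%:R `^ (- (1 / 6)).
Let b : R := ln q%:R `^ (1 / 2).

Let q_gt0 : 0 < q%:R :> R. Proof. by rewrite ltr0n (ltn_trans _ q1). Qed.
Let a_gt0 : 0 < a. Proof. by rewrite powR_gt0. Qed.
Let b_ge0 : 0 <= b. Proof. by rewrite powR_ge0. Qed.

Let a6 : a ^+ 6 * q%:R = 1.
Proof.
rewrite -powR_mulrn ?ltW// -powRrM (_ : - (1 / 6) * 6%:R = -1); last by lra.
by rewrite powR_inv1 ?ltW// mulVf ?gt_eqF.
Qed.

Let b2 : b ^+ 2 = ln q%:R.
Proof.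
rewrite -powR_mulrn// -powRrM (_ : 1 / 2 * 2%:R = 1); last by lra.
by rewrite powRr1// ln_ge0// ler1n ltnW.
Qed.

(** The constant 32 comes from [a >= 1 / 16] and [b >= 1 / 2]. *)
Lemma scale_small : (q < 16)%N -> 1 <= 32 * a * b.
Proof.
move=> q16; have q16R : q%:R <= 16 :> R by rewrite ler_nat ltnW.
have q2 : 2 <= q%:R :> R by rewrite ler_nat.
have b1 : 1 / 2 <= b.
  have : 1 / 2 <= b ^+ 2; last by have := b_ge0; nra.
  have qV : (q%:R)^-1 <= 1 / 2 :> R by rewrite div1r lef_pV2// posrE.
  have qV0 : 0 < (q%:R)^-1 :> R by rewrite invr_gt0.
  (* This is [ln (1 / q) <= 1 / q - 1 <= - 1 / 2], so [b ^+ 2 = ln q >= 1 / 2]. *)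
  have := @le_ln1Dx R (q%:R^-1 - 1); rewrite addrCA subrr addr0 lnV ?posrE// b2.
  by move=> /(_ _); lra.
have a1 : 1 / 16 <= a.
  rewrite leNgt; apply/negP => a16.
  have : a ^+ 6 <= a by rewrite ler_iXnr// ?ltW//; lra.
  have := a6; have := a_gt0; nra.
nra.
Qed.

(** From [a ^+ 6 * q = 1] one gets [1 / k <= 8 * a ^+ 2], so [s ^+ 2 <= 8 * a ^+ 2 * b ^+ 2], and 3
    exceeds the square root of 8. *)
Lemma scale_large (k : nat) (s : R) : (0 < k)%N -> (q <= (8 * k) ^ 3)%N ->
  s ^+ 2 * k%:R = ln q%:R -> s <= 3 * a * b.
Proof.
move=> k0 qk sk; have k0R : 0 < k%:R :> R by rewrite ltr0n.
have h : 1 <= 8 * k%:R * a ^+ 2.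
  have ka : 0 <= 8 * k%:R * a ^+ 2 by rewrite !mulr_ge0 ?sqr_ge0// ltW.
  rewrite -(@ler_pXn2r R 3 isT) ?nnegrE// expr1n exprMn -exprM -[leLHS]a6.
  rewrite mulrC ler_wpM2r ?exprn_ge0 ?(ltW a_gt0)//.
  by rewrite -(ler_nat R) natrX natrM in qk.
have [s0|s0] := leP s 0; first by rewrite (le_trans s0)// !mulr_ge0// ltW.
have ab : 0 <= 3 * a * b by rewrite !mulr_ge0// ltW.
rewrite -(@ler_pXn2r R 2 isT) ?nnegrE ?(ltW s0)//.
rewrite -(ler_pM2r k0R) sk -b2 !exprMn.
have := sqr_ge0 b; nra.
Qed.

End Scale.

Theorem theorem1p6 (R : realType) :
  exists c : R, forall G : finZmodType,
    (1 < #|G|)%N -> ~~ (3 %| #|G|)%N ->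
    exists A : {set G},
      [/\ standard A,
          delta_bar R A = 1 / 2
        & lambda_plus R A
            <= c * (#|G|%:R `^ (- (1 / 6))) * ((ln #|G|%:R) `^ (1 / 2)) ].
Proof.
exists 32 => G q1 q3.
have [big|small] := leP 1 (32 * (#|G|%:R `^ (- (1 / 6))) * (ln #|G|%:R `^ (1 / 2) : R)).
  have [t tf] := exists_relation_free1 q1 q3.
  have stA := tuple_set_standard t; exists (tuple_set t); split => //.
    by rewrite /delta_bar Delta_bar_tuple_set.
  exact: le_trans (lambda_plus_le1 R stA) big.
have q16 : (16 <= #|G|)%N.
  by rewrite leqNgt; apply/negP => /(scale_small R q1); rewrite leNgt small.
have [k [k0 kq qk]] := cube_scale q16.
have k0R : 0 < k%:R :> R by rewrite ltr0n.
pose s : R := Num.sqrt (ln #|G|%:R / k%:R).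
have s0 : 0 <= s by exact: sqrtr_ge0.
have sk : s ^+ 2 * k%:R = ln #|G|%:R.
  by rewrite sqr_sqrtr ?divfK ?gt_eqF// divr_ge0// ln_ge0// ler1n ltnW.
have sX := scale_large q1 k0 qk sk.
(* In this case 32 times the product of powers is below 1, so [s < 3 / 32]. *)
have s01 : 0 <= s <= 1 / 2 by rewrite s0 /=; lra.
have [t tf tgood] := exists_good_tuple q1 q3 kq s01 sk.
exists (tuple_set t); split; first exact: tuple_set_standard.
  by rewrite /delta_bar Delta_bar_tuple_set.
(* The weight at zero is [K = 10 * k * s], so that [K / 2] matches the threshold of the good tuple;
   the ratio [5 * s] stays within 15 of the allowed 32. *)
apply: (@le_trans _ _ (10 * k%:R * s / (2 * k%:R))).
  apply: lambda_plus_le_test_fun => //; first by rewrite !mulr_ge0.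
  by move=> g gc; apply: le_trans (tgood g gc); rewrite lerN2; lra.
rewrite (_ : 10 * k%:R * s / (2 * k%:R) = 5 * s); last by field; rewrite gt_eqF.
lra.
Qed.
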